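(* Let $p,q\in\mathbb{R}$, and assume that the matrix inequality $$\Phi(A^p)^{1/p}\le\Phi(A^q)^{1/q}$$ holds for every unital completely positive linear map $\Phi:\mathbb{M}_3\to\mathbb{M}_2$ and every $A\in\mathbb{P}_3$. Then $(p,q)$ satisfies at least one of the following conditions: (i) $p=q$; (ii) $1\le p<q$; (iii) $p<q\le-1$; (iv) $p\le-1$ and $q\ge1$; (v) $1/2\le p<1\le q$; (vi) $p\le-1<q\le-1/2$.
   Context: $\mathbb{M}_n$ denotes the algebra of $n\times n$ complex matrices and $\mathbb{P}_n$ the set of positive definite matrices in $\mathbb{M}_n$. A linear map $\Phi:\mathbb{M}_n\to\mathbb{M}_m$ is unital if $\Phi(I_n)=I_m$. For Hermitian matrices $X,Y$, $X\le Y$ means that $Y-X$ is positive semidefinite. Real powers, logarithms and exponentials of matrices are taken in the sense of functional calculus. Convention for exponent zero: when $p=0$, the expression $\Phi(A^p)^{1/p}$ means $\exp\Phi(\log A)$ (the limit as $p\to0$), and likewise for $q=0$. *)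

(* Defs.v *)
From HB Require Import structures.
From mathcomp Require Import all_boot all_order all_algebra.
From mathcomp Require Export complex.
From mathcomp Require Import all_reals exp.

Set Implicit Arguments.
Unset Strict Implicit.
Unset Printing Implicit Defensive.

Import Order.TTheory GRing.Theory Num.Theory.
Local Open Scope ring_scope.
Local Open Scope complex_scope.
Local Open Scope sesquilinear_scope.

(* In the order of R[i], 0 <= z means that z is real and nonnegative. *)
Definition psdmx (R : realType) n (A : 'M[R[i]]_n) : Prop :=
  A \is hermsymmx /\ forall v : 'cV[R[i]]_n, 0 <= (v ^t* *m A *m v) 0 0.

Definition pdmx (R : realType) n (A : 'M[R[i]]_n) : Prop :=
  A \is hermsymmx /\
  forall v : 'cV[R[i]]_n, v != 0 -> 0 < (v ^t* *m A *m v) 0 0.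

Definition loewner_le (R : realType) n (X Y : 'M[R[i]]_n) : Prop :=
  psdmx (Y - X).

(* Functional calculus of a Hermitian matrix: by orthomx_spectralP,
   A = invmx P *m diag_mx D *m P with P := spectralmx A unitary and
   D := spectral_diag A, which is real by hermitian_spectral_diag_real.
   Junk value when A is not Hermitian. *)
Definition mxfun (R : realType) n (f : R -> R) (A : 'M[R[i]]_n) : 'M[R[i]]_n :=
  invmx (spectralmx A)
    *m diag_mx (map_mx (fun z : R[i] => (f (complex.Re z))%:C) (spectral_diag A))
    *m spectralmx A.

Definition mxpowR (R : realType) n (A : 'M[R[i]]_n) (p : R) : 'M[R[i]]_n :=
  mxfun (fun x => x `^ p) A.

Definition mxln (R : realType) n (A : 'M[R[i]]_n) : 'M[R[i]]_n :=
  mxfun (@ln R) A.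

Definition mxexp (R : realType) n (A : 'M[R[i]]_n) : 'M[R[i]]_n :=
  mxfun (@sequences.expR R) A.

(* \mxblock_(i < k, j < k) B i j is an arbitrary element of M_k(M_n), and
   the conclusion is about its image under id_k (x) Phi. *)
Definition completely_positive (R : realType) n m
    (Phi : 'M[R[i]]_n -> 'M[R[i]]_m) : Prop :=
  forall (k : nat) (B : 'I_k -> 'I_k -> 'M[R[i]]_n),
    psdmx (\mxblock_(i < k, j < k) B i j) ->
    psdmx (\mxblock_(i < k, j < k) Phi (B i j)).

Definition unital (R : realType) n m (Phi : 'M[R[i]]_n -> 'M[R[i]]_m) : Prop :=
  Phi 1%:M = 1%:M.

(* Phi(A^p)^(1/p), read as exp(Phi(log A)) when p = 0. *)
Definition power_mean (R : realType) n m (Phi : 'M[R[i]]_n -> 'M[R[i]]_m)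
    (p : R) (A : 'M[R[i]]_n) : 'M[R[i]]_m :=
  if p == 0 then mxexp (Phi (mxln A)) else mxpowR (Phi (mxpowR A p)) p^-1.

(* Main.v *)
(* For V a real 3 x 2 isometry with rows (b_i, c_i) and A = diag(a_1, a_2, a_3),
   the compression Phi(X) = V^* X V is unital and completely positive. Testing
   the matrix inequality on an eigenvector v of Phi(A^q) and bounding the left
   side below by its spectral part along an eigenvector u of Phi(A^p) gives
     mu^(1/p) <u, v>^2 <= lambda^(1/q) |u|^2 |v|^2,
   where mu and lambda are the eigenvalues. Replacing A by A^-1 exchanges (p, q)
   with (-q, -p). Scalar tests force p <= q, so it remains to exclude p < q with
   -1 < p < 1/2. There take A = diag(1, 2, 2^n): up to an affine change,
   Phi(A^r) depends on r only through S = 1 + w + ... + w^(n-1), w = 2^r. The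
   bottom eigenvector v for q keeps lambda^(1/q) <= 2, the top eigenvalue for p
   has mu^(1/p) of order 2^n, and the two bases are tilted against each other by
   at least a constant times d / S, where d is the coupling in V. With d^2 of
   order min(1, w^n) this makes an exponential in n bounded by C n^2. *)
Require Import Defs.
From HB Require Import structures.
From mathcomp Require Import all_boot all_order all_algebra.
From mathcomp Require Import all_reals exp.
From mathcomp Require Import archimedean zify ring lra.
Import Order.TTheory GRing.Theory Num.Theory.
Local Open Scope ring_scope.
Local Open Scope complex_scope.
Local Open Scope sesquilinear_scope.
Set Implicit Arguments.
Unset Strict Implicit.
Unset Printing Implicit Defensive.

(** * Quadratic forms and block matrices *)

Lemma trmxC_mul {C : numClosedFieldType} m n k
  (A : 'M[C]_(m, n)) (B : 'M[C]_(n, k)) : (A *m B)^t* = B^t* *m A^t*.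
Proof. by rewrite trmx_mul map_mxM. Qed.

(* Expands the form of [M] at [(u^* u) v - (u^* v) u]. *)
Lemma psd_eigen_le {C : numClosedFieldType} n (M : 'M[C]_n) (l : C)
    (u v : 'cV[C]_n) :
  M^t* = M -> (forall z : 'cV[C]_n, 0 <= (z^t* *m M *m z) 0 0) ->
  l \is Num.real -> M *m u = l *: u -> 0 < (u^t* *m u) 0 0 ->
  l * `|(u^t* *m v) 0 0| ^+ 2 <= (u^t* *m u) 0 0 * (v^t* *m M *m v) 0 0.
Proof.
move=> hM pM lr Mu; set a := (u^t* *m u) 0 0; set b := (u^t* *m v) 0 0 => a0.
set X := (v^t* *m M *m v) 0 0.
have trZ c (y : 'cV[C]_n) : (c *: y)^t* = Num.conj c *: y^t*.
  by apply/matrixP => i j; rewrite !mxE rmorphM.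
have uM : u^t* *m M = l *: u^t* by rewrite -hM -trmxC_mul Mu trZ conj_Creal.
have vu : (v^t* *m u) 0 0 = Num.conj b.
  have -> : v^t* *m u = (u^t* *m v)^t* by rewrite trmxC_mul trmxCK.
  by rewrite 2!mxE.
have := pM (a *: v - b *: u).
have -> : (a *: v - b *: u)^t* = Num.conj a *: v^t* - Num.conj b *: u^t*.
  by rewrite -!trZ; apply/matrixP => i j; rewrite !mxE rmorphB.
rewrite (conj_Creal (gtr0_real a0)).
rewrite !mulmxBl !mulmxBr -!scalemxAl -!scalemxAr uM.
rewrite -(mulmxA _ M u) Mu -!scalemxAl -!scalemxAr.
have ZE x (y : 'M[C]_1) : (x *: y) 0 0 = x * y 0 0 by rewrite mxE.
have BE (y z : 'M[C]_1) : (y - z) 0 0 = y 0 0 - z 0 0 by rewrite !mxE.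
rewrite !(BE, ZE) vu -/a -/b -/X normCK.
have -> : a * (a * X) - a * (b * (l * Num.conj b))
    - (Num.conj b * (a * (l * b)) - Num.conj b * (b * (l * a)))
    = a * (a * X - l * (b * Num.conj b)) by ring.
by rewrite pmulr_rge0 // subr_ge0.
Qed.

Lemma mxblock_sandwich {K : pzSemiRingType} m n k (U : 'M[K]_(m, n))
    (V : 'M[K]_(n, m)) (B : 'I_k -> 'I_k -> 'M[K]_n) :
  \mxblock_(i < k, j < k) (if i == j then U else 0) *m
  \mxblock_(i < k, j < k) B i j *m
  \mxblock_(i < k, j < k) (if i == j then V else 0)
  = \mxblock_(i < k, j < k) (U *m B i j *m V).
Proof.
rewrite !mul_mxblock; apply: eq_mxblock => i j.
rewrite (bigD1 j) //= [X in _ + X]big1 => [|s /negPf sj]; last first.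
  by rewrite sj mulmx0.
rewrite eqxx addr0 (bigD1 i) //= [X in _ + X]big1 => [|s]; last first.
  by rewrite eq_sym => /negPf si; rewrite si mul0mx.
by rewrite eqxx addr0.
Qed.

Lemma quadB {K : pzRingType} n (x : 'rV[K]_n) (A B : 'M[K]_n) (y : 'cV[K]_n) :
  (x *m (A - B) *m y) 0 0 = (x *m A *m y) 0 0 - (x *m B *m y) 0 0.
Proof. by rewrite mulmxBr mulmxBl !mxE. Qed.

Lemma quad_eigen {K : comPzRingType} n (x : 'rV[K]_n) (A : 'M[K]_n)
    (l : K) (y : 'cV[K]_n) :
  A *m y = l *: y -> (x *m A *m y) 0 0 = l * (x *m y) 0 0.
Proof. by move=> Ay; rewrite -mulmxA Ay -scalemxAr mxE. Qed.

(** * Functional calculus, the Loewner order and compressions *)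

Section Matrices.
Variable R : realType.
Local Notation C := R[i].
Local Notation rc := (real_complex R).

Lemma hermsymmxP n (A : 'M[C]_n) : reflect (A^t* = A) (A \is hermsymmx).
Proof.
apply: (iffP (is_hermitianmxP _ _ _)); rewrite expr0 scale1r; exact: esym.
Qed.

Lemma trmxC_real m n (A : 'M[R]_(m, n)) : (map_mx rc A)^t* = map_mx rc A^T.
Proof. by apply/matrixP => i j; rewrite !mxE; exact: conjc_real. Qed.

Lemma psdmx_congr m n (A : 'M[C]_n) (V : 'M[C]_(n, m)) :
  psdmx A -> psdmx (V^t* *m A *m V).
Proof.
case=> /hermsymmxP hA pA; split=> [|v].
  by apply/hermsymmxP; rewrite !trmxC_mul trmxCK hA mulmxA.
by have := pA (V *m v); rewrite trmxC_mul !mulmxA.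
Qed.

Lemma diag_mx_quad n (d : 'rV[R]_n) (v : 'cV[C]_n) :
  (v^t* *m diag_mx (map_mx rc d) *m v) 0 0
  = \sum_i (d 0 i)%:C * `|v i 0| ^+ 2.
Proof.
rewrite mxE; apply: eq_bigr => i _.
by rewrite mul_mx_diag !mxE normCKC mulrA (mulrC (_%:C)).
Qed.

Lemma hermsymmx_diag n (d : 'rV[R]_n) :
  diag_mx (map_mx rc d) \is hermsymmx.
Proof.
by apply/hermsymmxP; rewrite -map_diag_mx trmxC_real tr_diag_mx.
Qed.

Lemma psdmx_diag n (d : 'rV[R]_n) :
  (forall i, 0 <= d 0 i) -> psdmx (diag_mx (map_mx rc d)).
Proof.
move=> d0; split=> [|v]; first exact: hermsymmx_diag.
rewrite diag_mx_quad sumr_ge0// => i _.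
by rewrite mulr_ge0 ?ler0c ?d0 ?exprn_ge0 ?normr_ge0.
Qed.

Lemma pdmx_diag n (d : 'rV[R]_n) :
  (forall i, 0 < d 0 i) -> pdmx (diag_mx (map_mx rc d)).
Proof.
move=> d0; split=> [|v vN0]; first exact: hermsymmx_diag.
have ge0 i : 0 <= (d 0 i)%:C * `|v i 0| ^+ 2.
  by rewrite mulr_ge0 ?ler0c ?(ltW (d0 i)) ?exprn_ge0 ?normr_ge0.
rewrite diag_mx_quad lt0r sumr_ge0 // andbT.
apply: contra vN0 => /eqP s0; apply/eqP/colP => i; rewrite mxE.
have /eqP := (psumr_eq0P (fun i _ => ge0 i) s0) i isT.
rewrite mulf_eq0 expf_eq0 /= normr_eq0 => /orP[/eqP|/eqP//].
by case=> di; have := d0 i; rewrite di ltxx.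
Qed.

Lemma mxfun_psd n (f : R -> R) (A : 'M[C]_n) :
  (forall x, 0 <= f x) -> psdmx (mxfun f A).
Proof.
move=> f0; rewrite /mxfun invmx_unitary ?spectral_unitarymx //.
set D := spectral_diag A.
have -> : map_mx (fun z : C => (f (complex.Re z))%:C) D
    = map_mx rc (map_mx (fun z => f (complex.Re z)) D).
  by apply/matrixP => i j; rewrite !mxE.
by apply/psdmx_congr/psdmx_diag => i; rewrite mxE.
Qed.

(** Each coordinate of [P *m v] either vanishes or sits at a diagonal entry equal to [l], so
    applying [f] to the entries multiplies it by [f l]. Eigenvectors thus replace the basis chosen
    by [spectralmx]. *)
Lemma mxfun_eigen n (f : R -> R) (A : 'M[C]_n) (l : R) (v : 'cV[C]_n) :
  A \is normalmx -> A *m v = l%:C *: v -> mxfun f A *m v = (f l)%:C *: v.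
Proof.
move=> /orthomx_spectralP; rewrite /mxfun.
set P := spectralmx A; set D := spectral_diag A => AE Av.
have Pu : P \in unitmx by exact: spectral_unit.
have DPv : diag_mx D *m (P *m v) = l%:C *: (P *m v).
  by rewrite scalemxAr -Av [RHS]mulmxA [in RHS]AE -!mulmxA mulKVmx.
rewrite -!mulmxA -[RHS](mulKmx Pu) -scalemxAr; congr (_ *m _).
apply/colP => i; have /colP/(_ i) := DPv.
rewrite !mul_diag_mx !mxE => /eqP.
rewrite -subr_eq0 -mulrBl mulf_eq0 subr_eq0 => /orP[/eqP -> //|/eqP ->].
by rewrite !mulr0.
Qed.

(** The standard basis vectors are eigenvectors, so [mxfun_eigen] gives every column. *)
Lemma mxfun_diag n (f : R -> R) (d : 'rV[R]_n) :
  mxfun f (diag_mx (map_mx rc d)) = diag_mx (map_mx rc (map_mx f d)).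
Proof.
apply/matrixP => i j; set M := mxfun _ _.
have Mj : M *m delta_mx j 0 = (f (d 0 j))%:C *: delta_mx j (0 : 'I_1).
  apply: mxfun_eigen; first exact/hermitian_normalmx/hermsymmx_diag.
  apply/colP => k; rewrite mul_diag_mx !mxE.
  by case: eqVneq => [->|_]; rewrite ?andFb ?mulr0.
have /colP/(_ i) := Mj; rewrite -colE !mxE eqxx andbT => ->.
by case: eqVneq => [->|_]; rewrite ?mulr1 ?mulr0 ?mulr1n ?mulr0n.
Qed.

Lemma psdmx_eigen_le n (M : 'M[C]_n) (l : R) (u v : 'cV[R]_n) :
  psdmx M -> M *m map_mx rc u = l%:C *: map_mx rc u ->
  0 < (u^T *m u) 0 0 ->
  (l * (u^T *m v) 0 0 ^+ 2)%:C
    <= ((u^T *m u) 0 0)%:C * ((map_mx rc v)^t* *m M *m map_mx rc v) 0 0.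
Proof.
case=> /hermsymmxP hM pM Mu a0.
have E x y : ((map_mx rc x)^t* *m map_mx rc y) 0 0 = ((x^T *m y : 'M_1) 0 0)%:C.
  by rewrite trmxC_real -map_mxM mxE.
have lr : l%:C \is Num.real by apply/complex_realP; exists l.
have := psd_eigen_le (map_mx rc v) hM pM lr Mu.
rewrite !E ltcR => /(_ a0).
suff -> : `|((u^T *m v) 0 0)%:C| ^+ 2 = ((u^T *m v) 0 0 ^+ 2)%:C :> C.
  by rewrite -rmorphM.
rewrite real_normK ?rmorphXn //.
by apply/complex_realP; eexists.
Qed.

(** Evaluate both forms at [v]: that of [Y] is [l] times |v|^2, and [psdmx_eigen_le] bounds that of
    [X] from below. *)
Lemma loewner_eigen_le n (X Y : 'M[C]_n) (k l : R) (u v : 'cV[R]_n) :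
  loewner_le X Y -> psdmx X ->
  X *m map_mx rc u = k%:C *: map_mx rc u ->
  Y *m map_mx rc v = l%:C *: map_mx rc v -> 0 < (u^T *m u) 0 0 ->
  k * (u^T *m v) 0 0 ^+ 2 <= l * (u^T *m u) 0 0 * (v^T *m v) 0 0.
Proof.
move=> [_ /(_ (map_mx rc v)) XY] pX Xu Yv u0.
have /le_trans := psdmx_eigen_le v pX Xu u0.
move: XY; rewrite quadB (quad_eigen _ Yv) subr_ge0 => XY.
have vv : ((map_mx rc v)^t* *m map_mx rc v) 0 0 = ((v^T *m v) 0 0)%:C.
  by rewrite trmxC_real -map_mxM mxE.
rewrite vv in XY.
move=> /(_ ((u^T *m u) 0 0 * (l * (v^T *m v) 0 0))%:C); rewrite lecR => H.
rewrite (mulrC l) -mulrA; apply: H.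
rewrite [X in _ <= X]rmorphM; apply: ler_wpM2l; first by rewrite ler0c ltW.
by rewrite rmorphM.
Qed.

(* [powr r] and [invpowr r] are [t |-> t^r] and its inverse, with [ln] and
   [expR] at [r = 0]. *)
Definition powr (r t : R) : R := if r == 0 then ln t else t `^ r.
Definition invpowr (r t : R) : R :=
  if r == 0 then sequences.expR t else t `^ r^-1.

Lemma invpowr_ge0 r t : 0 <= invpowr r t.
Proof. by rewrite /invpowr; case: eqP; rewrite ?powR_ge0 ?expR_ge0. Qed.

(** On diagonal matrices both branches of [power_mean] take one form, so exponent 0 stays out of the
    matrix arguments. *)
Lemma power_meanE n m (Phi : 'M[C]_n -> 'M[C]_m) r (a : 'rV[R]_n) :
  power_mean Phi r (diag_mx (map_mx rc a)) =
  mxfun (invpowr r) (Phi (diag_mx (map_mx rc (map_mx (powr r) a)))).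
Proof.
rewrite /power_mean /invpowr /powr /mxexp /mxln /mxpowR.
by case: eqP => _; rewrite mxfun_diag.
Qed.

(** Written as a composite of two multiplications so that its linear structure can be inferred. *)
Definition compression m n (V : 'M[C]_(n, m)) : 'M[C]_n -> 'M[C]_m :=
  mulmxr V \o mulmx (V^t*).

HB.instance Definition _ m n (V : 'M[C]_(n, m)) :=
  GRing.Linear.on (compression V).

Lemma compression_unital m n (V : 'M[C]_(n, m)) :
  V^t* *m V = 1%:M -> unital (compression V).
Proof. by rewrite /unital /compression /= mulmx1. Qed.

(** Applied blockwise, the map is the congruence by the block diagonal matrix with [k] copies of
    [V]. *)
Lemma compression_cp m n (V : 'M[C]_(n, m)) :
  completely_positive (compression V).
Proof.
move=> k B /(psdmx_congr (\mxblock_(i < k, j < k) (if i == j then V else 0))).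
rewrite tr_mxblock.
have -> : map_mx Num.conj (\mxblock_(i < k, j < k) (if j == i then V else 0)^T)
    = \mxblock_(i < k, j < k) (if i == j then V^t* else 0).
  apply/matrixP => i j; rewrite !mxE eq_sym.
  by case: ifP => _; rewrite !mxE // conjC0.
by rewrite mxblock_sandwich.
Qed.

(* [gram f a b b], [gram f a b c], [gram f a c c] are the entries of
   [V^T *m diag (f a) *m V] for [V] with columns [b] and [c]. *)
Definition gram (f : R -> R) (a x y : 'I_3 -> R) : R :=
  \sum_i f (a i) * (x i * y i).

(** Entrywise eigenvector equation of the 2 x 2 compression, with eigenvalue [m] and vector
    [(u1, u2)]. *)
Definition gram_eigen (f : R -> R) (a b c : 'I_3 -> R) (m u1 u2 : R) : Prop :=
  gram f a b b * u1 + gram f a b c * u2 = m * u1 /\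
  gram f a b c * u1 + gram f a c c * u2 = m * u2.

(** The only consequence of the matrix inequality used later; it speaks of real numbers alone.
    Positivity of both means lets them be inverted when [A] is replaced by its inverse. *)
Definition eigen_le (p q : R) : Prop :=
  forall (a b c : 'I_3 -> R) (l m u1 u2 v1 v2 : R),
  (forall i, 0 < a i) ->
  \sum_i b i * b i = 1 -> \sum_i b i * c i = 0 -> \sum_i c i * c i = 1 ->
  gram_eigen (powr p) a b c m u1 u2 -> gram_eigen (powr q) a b c l v1 v2 ->
  0 < u1 ^+ 2 + u2 ^+ 2 -> 0 < v1 ^+ 2 + v2 ^+ 2 ->
  0 < invpowr p m -> 0 < invpowr q l ->
  invpowr p m * (u1 * v1 + u2 * v2) ^+ 2
    <= invpowr q l * (u1 ^+ 2 + u2 ^+ 2) * (v1 ^+ 2 + v2 ^+ 2).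

Lemma power_mean_le_eigen_le p q :
  (forall Phi : {linear 'M[C]_3 -> 'M[C]_2},
     unital Phi -> completely_positive Phi ->
     forall A : 'M[C]_3, pdmx A ->
       loewner_le (power_mean Phi p A) (power_mean Phi q A)) ->
  eigen_le p q.
Proof.
move=> h a b c l m u1 u2 v1 v2 a0 bb bc cc Hu Hv u0 _ _ _.
pose W : 'M[R]_(3, 2) := \matrix_(i, j) (if j == 0 then b i else c i).
pose vec x y : 'cV[R]_2 := \col_j (if j == 0 then x else y).
pose V := map_mx rc W.
have Vt : V^t* = map_mx rc W^T by rewrite trmxC_real.
have WW : W^T *m W = 1%:M.
  apply/matrixP => i j; rewrite !mxE; under eq_bigr do rewrite !mxE.
  case: i j => [[|[|//]] i] [[|[|//]] j] //=.
    by under eq_bigr do rewrite mulrC.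
have VV : V^t* *m V = 1%:M by rewrite Vt -map_mxM WW map_mx1.
pose d f : 'rV[R]_3 := \row_i f (a i).
have ZE f : compression V (diag_mx (map_mx rc (d f)))
    = map_mx rc (W^T *m diag_mx (d f) *m W).
  by rewrite /compression /= Vt -map_diag_mx -!map_mxM.
have eig f k x y : gram_eigen f a b c k x y ->
    W^T *m diag_mx (d f) *m W *m vec x y = k *: vec x y.
  case=> e1 e2; apply/colP => j; rewrite !mxE.
  rewrite !big_ord_recl big_ord0 addr0 !mxE /=.
  under eq_bigr do rewrite mul_mx_diag !mxE.
  under [X in _ + X * _]eq_bigr do rewrite mul_mx_diag !mxE.
  case: j => [[|[|//]] j] /=.
    rewrite -e1; congr (_ * _ + _ * _); apply: eq_bigr => i _; ring.
  rewrite -e2; congr (_ * _ + _ * _); apply: eq_bigr => i _; ring.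
have dot x1 x2 y1 y2 : ((vec x1 x2)^T *m vec y1 y2) 0 0 = x1 * y1 + x2 * y2.
  by rewrite !mxE !big_ord_recl big_ord0 addr0 !mxE.
have herm f : compression V (diag_mx (map_mx rc (d f))) \is normalmx.
  apply/hermitian_normalmx/hermsymmxP.
  by rewrite ZE trmxC_real !trmx_mul tr_diag_mx trmxK mulmxA.
have eigC f g k x y : gram_eigen f a b c k x y ->
    mxfun g (compression V (diag_mx (map_mx rc (d f)))) *m map_mx rc (vec x y)
    = (g k)%:C *: map_mx rc (vec x y).
  move=> /eig e; apply: mxfun_eigen; first exact: herm.
  by rewrite ZE -map_mxM e map_mxZ.
have dE r : map_mx (powr r) (d id) = d (powr r) by apply/rowP => i; rewrite !mxE.
have le_pq : loewner_le (mxfun (invpowr p) (compression V (diag_mx (map_mx rc (d (powr p))))))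
    (mxfun (invpowr q) (compression V (diag_mx (map_mx rc (d (powr q)))))).
  rewrite -!dE -!power_meanE; apply: h.
  - exact: compression_unital.
  - exact: compression_cp.
  - by apply: pdmx_diag => i; rewrite mxE.
have := loewner_eigen_le le_pq (mxfun_psd _ (@invpowr_ge0 p))
  (eigC _ _ _ _ _ Hu) (eigC _ _ _ _ _ Hv).
by rewrite !dot -!expr2; apply.
Qed.

End Matrices.

(** * Inversion symmetry and two-point means *)

Section Means.
Variable R : realType.
Implicit Types (p q r t : R) (n : nat).

Lemma gram_eigen_scale (f g : R -> R) (k : R) (a a' b c : 'I_3 -> R) (m u1 u2 : R) :
  (forall i, g (a' i) = k * f (a i)) ->
  gram_eigen f a b c m u1 u2 -> gram_eigen g a' b c (k * m) u1 u2.
Proof.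
move=> fg; have E x y : gram g a' x y = k * gram f a x y.
  rewrite /gram mulr_sumr; apply: eq_bigr => i _. by rewrite fg -mulrA.
case=> e1 e2; split; rewrite !E -!mulrA -mulrDr. by rewrite e1. by rewrite e2.
Qed.

(** Inverting [t] changes the sign of [ln t] but the exponent of t^r; the factor merges the two
    cases. *)
Lemma powrV r t : 0 < t ->
  powr r t^-1 = (if r == 0 then -1 else 1) * powr (- r) t.
Proof.
move=> t0; rewrite /powr oppr_eq0; case: eqP => _.
  by rewrite lnV ?mulN1r.
by rewrite mul1r powRN -powR_inv1 ?ltW // -powRrM mulN1r powRN.
Qed.

Lemma invpowrV r t :
  invpowr r ((if r == 0 then -1 else 1) * t) = (invpowr (- r) t)^-1.
Proof.
rewrite /invpowr oppr_eq0; case: eqP => _; first by rewrite mulN1r expRN.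
by rewrite mul1r invrN powRN invrK.
Qed.

(* The inequality for [(p, q)] at [A^-1] is the one for [(-q, -p)] at [A]. *)
Lemma eigen_le_opp p q : eigen_le p q -> eigen_le (- q) (- p).
Proof.
move=> H a b c l m u1 u2 v1 v2 a0 bb bc cc Hu Hv u0 v0 m0 l0.
have := H (fun i => (a i)^-1) b c ((if q == 0 then -1 else 1) * m)
  ((if p == 0 then -1 else 1) * l) v1 v2 u1 u2.
rewrite !invpowrV !invr_gt0 => /(_ _ bb bc cc _ _ v0 u0 l0 m0) K.
have {}K := K (fun i => etrans (invr_gt0 _) (a0 i))
  (gram_eigen_scale (fun i => powrV _ (a0 i)) Hv)
  (gram_eigen_scale (fun i => powrV _ (a0 i)) Hu).
move: K; rewrite -mulrA ler_pdivrMl // mulrCA ler_pdivlMl //.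
by rewrite (mulrC v1) (mulrC v2) (mulrC (v1 ^+ 2 + _)) !mulrA.
Qed.

Lemma ler0_ler_powR r t u : r <= 0 -> 0 < t -> t <= u -> u `^ r <= t `^ r.
Proof.
move=> r0 t0 tu; have u0 := lt_le_trans t0 tu.
rewrite -[r]opprK !(powRN _ (- r)) lef_pV2 ?posrE ?powR_gt0 //.
by rewrite ge0_ler_powR ?oppr_ge0 ?nnegrE // ltW.
Qed.

Lemma gt1_ltr_powR t x y : 1 < t -> x < y -> t `^ x < t `^ y.
Proof.
by move=> t1 xy; rewrite /powR !gt_eqF ?(lt_trans ltr01) // ltr_expR ltr_pM2r // ln_gt0.
Qed.

Lemma sqrrt t : 0 <= t -> Num.sqrt t * Num.sqrt t = t.
Proof. by move=> t0; rewrite -expr2 sqr_sqrtr. Qed.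

Definition fun3 t1 t2 t3 : 'I_3 -> R := fun i => [:: t1; t2; t3]`_i.

Lemma sum3 (f : 'I_3 -> R) : \sum_i f i = f 0 + f 1 + f 2%:R.
Proof.
rewrite !big_ord_recl big_ord0 addr0 addrA.
by congr (f _ + f _ + f _); apply: val_inj.
Qed.

Lemma gram3 (f : R -> R) a1 a2 a3 b1 b2 b3 c1 c2 c3 :
  gram f (fun3 a1 a2 a3) (fun3 b1 b2 b3) (fun3 c1 c2 c3) =
  f a1 * (b1 * c1) + f a2 * (b2 * c2) + f a3 * (b3 * c3).
Proof. by rewrite /gram sum3. Qed.

(** With columns (s, s, 0) and (0, 0, 1), s^2 = 1/2, and A = diag(t, 1, 1), the vector (1, 0) is an
    eigenvector for both exponents, and its eigenvalue is the average of the two values. *)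
Lemma eigen_le_mean p q t : eigen_le p q -> 0 < t ->
  0 < invpowr p ((powr p t + powr p 1) / 2) ->
  0 < invpowr q ((powr q t + powr q 1) / 2) ->
  invpowr p ((powr p t + powr p 1) / 2)
    <= invpowr q ((powr q t + powr q 1) / 2).
Proof.
move=> H t0 p0 q0; pose s : R := Num.sqrt 2^-1.
have ss : s * s = 2^-1 by rewrite sqrrt // invr_ge0.
have E f : gram_eigen f (fun3 t 1 1) (fun3 s s 0) (fun3 0 0 1)
    ((f t + f 1) / 2) 1 0.
  by split; rewrite !gram3 ?ss; ring.
have a0 i : 0 < fun3 t 1 1 i by case: i => [[|[|[|//]]] i].
have bb : \sum_i fun3 s s 0 i * fun3 s s 0 i = 1.
  by rewrite sum3 /fun3 /= ss mulr0 addr0 -div1r -splitr.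
have bc : \sum_i fun3 s s 0 i * fun3 0 0 1 i = 0.
  by rewrite sum3 /fun3 /= !mulr0 mul0r !addr0.
have cc : \sum_i fun3 0 0 1 i * fun3 0 0 1 i = 1.
  by rewrite sum3 /fun3 /= !mulr0 mulr1 !add0r.
have := H _ _ _ _ _ _ _ _ _ a0 bb bc cc (E (powr p)) (E (powr q)).
move: p0 q0; move: (invpowr p _) (invpowr q _) => X Y p0 q0.
rewrite !(mulr1, mulr0, addr0, expr1n, expr0n) /=.
by apply.
Qed.

(** By inversion [p] may be taken positive. The [p]-mean of t and 1 is then at least 2^(-1/p), while
    for q < p a small t brings the [q]-mean below this value. *)
Lemma eigen_le_leq p q : eigen_le p q -> p <= q.
Proof.
wlog p0 : p q / 0 < p => [W H|H].
  have [/W/(_ H)//|p0] := ltP 0 p.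
  have [q0|q0] := ltP q 0; last exact: le_trans q0.
  rewrite -lerN2; apply: W; last exact: eigen_le_opp.
  by rewrite oppr_gt0.
rewrite leNgt; apply/negP => qp.
have pN0 : (p == 0) = false by rewrite gt_eqF.
suff [t t0 lt_qp] : exists2 t, 0 < t &
    0 < invpowr q ((powr q t + powr q 1) / 2) < 2^-1 `^ p^-1.
  move: lt_qp => /andP[q0 lt_qp].
  have half_le : 2^-1 <= (t `^ p + 1) / 2.
    by rewrite -[X in X <= _]mul1r ler_pM2r ?invr_gt0 // lerDr powR_ge0.
  have le_p : 2^-1 `^ p^-1 <= invpowr p ((powr p t + powr p 1) / 2).
    rewrite /invpowr /powr pN0 powR1 ge0_ler_powR ?invr_ge0 ?(ltW p0) //;
      rewrite ?nnegrE ?invr_ge0 //; apply: le_trans half_le; by rewrite invr_ge0.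
  have /(eigen_le_mean H t0)/(_ q0) : 0 < invpowr p ((powr p t + powr p 1) / 2).
    by apply: lt_le_trans le_p; rewrite powR_gt0 ?invr_gt0.
  by move=> le_pq; have := lt_le_trans lt_qp (le_trans le_p le_pq); rewrite ltxx.
set e := 2^-1 `^ p^-1.
have e0 : 0 < e by rewrite powR_gt0 ?invr_gt0.
have e2 : e / 2 < e by lra.
rewrite /invpowr /powr; case: (ltgtP q 0) => q0.
- have s0 : 0 < e / 2 by rewrite divr_gt0.
  (* Here t^q = 2 x with x = (e/2)^q, so the mean is (x + 1/2)^(1/q), at most x^(1/q) = e/2. *)
  exists ((e / 2) * 2 `^ q^-1); first by rewrite mulr_gt0 ?powR_gt0.
  rewrite powR1 [(_ * _ `^ _) `^ _]powRM ?(ltW s0) ?powR_ge0 // -powRrM mulVf ?lt_eqF // powRr1 //.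
  set x := (e / 2) `^ q; have x0 : 0 < x by rewrite powR_gt0.
  rewrite powR_gt0 /=; last lra.
  apply: le_lt_trans e2; have -> : e / 2 = x `^ q^-1.
    by rewrite -powRrM mulfV ?lt_eqF // powRr1 // ltW.
  by rewrite ler0_ler_powR ?invr_le0 ?(ltW q0) //; lra.
- have e1 : 2^-1 < e `^ q.
    rewrite -powRrM -powR_inv1 // -powRrM gt1_ltr_powR ?ltr1n // mulN1r.
    by rewrite ltrN2 mulrC ltr_pdivrMr ?mul1r.
  (* Chosen so that the average is (e^q + 1/2) / 2, which is below e^q. *)
  exists ((e `^ q - 2^-1) `^ q^-1); first by rewrite powR_gt0 ?subr_gt0.
  rewrite powR1 -powRrM mulVf ?gt_eqF // powRr1 ?subr_ge0 ?(ltW e1) //.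
  rewrite powR_gt0 /=; last lra.
  rewrite [ltRHS](_ : _ = (e `^ q) `^ q^-1); last first.
    by rewrite -powRrM mulfV ?gt_eqF // powRr1 // ltW.
  by rewrite gt0_ltr_powR ?invr_gt0 ?nnegrE //; lra.
(* The geometric mean of t and 1 is the square root of t, here e/2. *)
- exists ((e / 2) ^+ 2); first by rewrite exprn_gt0 ?divr_gt0.
  rewrite ln1 addr0 lnXn ?divr_gt0 // -[ln _ *+ 2]mulr_natr mulfK ?pnatr_eq0 //.
  by rewrite lnK ?posrE ?divr_gt0 //= divr_gt0.
Qed.

End Means.

(** * The family diag(1, 2, 2^n) and its eigenvectors *)

Section Counterexample.
Variable R : realType.
Implicit Types (p q r t w z d k S : R) (n : nat).

Definition geom_sum n w : R := \sum_(j < n) w ^+ j.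

(** For r != 0 this is w^n - 1 = (w - 1) S with w = 2^r. At r = 0 it also holds, since then w = 1
    and S = n. *)
Lemma powr_geom r n : powr r (2 ^+ n) =
  powr r 1 + (powr r 2 - powr r 1) * geom_sum n (2 `^ r).
Proof.
rewrite /powr /geom_sum; case: eqP => [->|_].
  rewrite lnXn // ln1 powRr0 subr0 add0r.
  by under eq_bigr do rewrite expr1n; rewrite sumr_const card_ord mulr_natr.
rewrite powR1 -subrX1 addrC subrK -powR_mulrn // -powRrM mulrC powRrM.
by rewrite powR_mulrn // powR_ge0.
Qed.

Lemma geom_sum_ge1 n w : (0 < n)%N -> 0 <= w -> 1 <= geom_sum n w.
Proof.
case: n => // n _ w0; rewrite /geom_sum big_ord_recl expr0 lerDl sumr_ge0 // => i _.
by rewrite exprn_ge0.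
Qed.

Lemma geom_sum_le n w : 0 <= w -> w <= 1 -> geom_sum n w <= n%:R.
Proof.
move=> w0 w1; rewrite -[n in n%:R]card_ord -sumr_const ler_sum // => i _.
by rewrite exprn_ile1.
Qed.

Lemma geom_sum_le_expr n w : 1 <= w -> geom_sum n w <= n%:R * w ^+ n.
Proof.
move=> w1; rewrite mulr_natl -[n in _ *+ n]card_ord -sumr_const ler_sum // => i _.
by rewrite ler_weXn2l // ltnW.
Qed.

(** The ratio of the two sums is at least its value for two terms, which separates them uniformly in
    [n]. *)
Lemma geom_sum_ratio n w z : 0 <= w -> w <= z ->
  (1 + z) * geom_sum n.+2 w <= (1 + w) * geom_sum n.+2 z.
Proof.
move=> w0 wz; elim: n => [|n IH].
  by rewrite /geom_sum !big_ord_recr !big_ord0 /= !expr0 !expr1 !add0r mulrC.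
rewrite /geom_sum !(big_ord_recr n.+2) /= -/(geom_sum n.+2 _) -/(geom_sum n.+2 z).
rewrite !mulrDr lerD // !mulrDl !mul1r lerD //.
  by rewrite lerXn2r // nnegrE // (le_trans w0).
rewrite !(exprS _ n.+1) !mulrA (mulrC z w) ler_wpM2l //.
  by rewrite mulr_ge0 // (le_trans w0).
by rewrite lerXn2r // nnegrE // (le_trans w0).
Qed.

Lemma expr_gt_quad w k : 1 < w -> exists n, k * (n.+2)%:R ^+ 2 < w ^+ n.+2.
Proof.
move=> w1.
wlog k0 : k / 0 < k => [H|].
  have [k0|k0] := ltP 0 k; first exact: H.
  exists 0%N; apply: le_lt_trans (_ : _ <= 0) _.
    by rewrite mulr_le0_ge0 ?exprn_ge0.
  by rewrite exprn_gt0 // (lt_trans ltr01).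
set h := w - 1; have h0 : 0 < h by rewrite subr_gt0.
have bernoulli m : m%:R * h <= w ^+ m.
  elim: m => [|m IH]; first by rewrite mul0r.
  have w_ge1 : 1 <= w ^+ m by rewrite exprn_ege1 // ltW.
  rewrite exprS -natr1 mulrDl mul1r.
  have -> : w * w ^+ m = w ^+ m + h * w ^+ m by rewrite /h; ring.
  by rewrite lerD // ler_peMr // ltW.
have x0 : 0 <= 9 * k / h ^+ 3 by rewrite divr_ge0 ?exprn_ge0 ?mulr_ge0 ?ltW.
set m := Num.bound (9 * k / h ^+ 3).
have xm : 9 * k / h ^+ 3 < m.+1%:R.
  by apply: lt_le_trans (archi_boundP x0) _; rewrite ler_nat.
(* A multiple of 3 lets the Bernoulli bound be cubed, which beats the quadratic; subtracting 2
   offsets [n.+2]. *)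
exists (m.+1 * 3 - 2)%N; have -> : (m.+1 * 3 - 2).+2 = (m.+1 * 3)%N by lia.
rewrite exprM natrM; apply: lt_le_trans (_ : _ < (m.+1%:R * h) ^+ 3) _.
  move: xm; rewrite ltr_pdivrMr ?exprn_gt0 // => xm.
  have m0 : 0 < m.+1%:R :> R by [].
  have -> : (m.+1%:R * h) ^+ 3 = m.+1%:R ^+ 2 * (m.+1%:R * h ^+ 3) by ring.
  have -> : k * (m.+1%:R * 3%:R) ^+ 2 = m.+1%:R ^+ 2 * (9 * k) by ring.
  by rewrite ltr_pM2l ?exprn_gt0.
have w0 : 0 <= w by rewrite (le_trans ler01) // ltW.
by rewrite lerXn2r ?nnegrE ?(exprn_ge0 _ w0) ?mulr_ge0 ?(ltW h0).
Qed.

(** [s] is the positive root 2 d / (k + sqrt(k^2 + 4 d^2)) of d s^2 + k s = d; both upper bounds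
    follow from this equation and k >= 1/2. *)
Lemma eigenvector_root k d : 2^-1 <= k -> 0 < d -> d <= 1 ->
  exists s, [/\ 0 < s, s <= 1, s <= 2 * d & d = s * (k + d * s)].
Proof.
move=> k2 d0 d1; pose D := Num.sqrt (k ^+ 2 + 4 * d ^+ 2).
have DD : D ^+ 2 = k ^+ 2 + 4 * d ^+ 2 by rewrite sqr_sqrtr //; nra.
have D0 : 0 <= D by rewrite sqrtr_ge0.
have k0 : 0 < k by lra.
have kD0 : 0 < k + D by lra.
have root : d = 2 * d / (k + D) * (k + d * (2 * d / (k + D))).
  have -> : 2 * d / (k + D) * (k + d * (2 * d / (k + D)))
      = (2 * k * d * (k + D) + 4 * d ^+ 2 * d) / (k + D) ^+ 2.
    by field; rewrite gt_eqF.
  apply: (mulIf (expf_neq0 2 (lt0r_neq0 kD0))).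
  rewrite mulfVK ?expf_neq0 ?lt0r_neq0 //.
  have -> : 4 * d ^+ 2 = D ^+ 2 - k ^+ 2 by rewrite DD; ring.
  by ring.
set s := 2 * d / (k + D) in root *.
have s0 : 0 < s by rewrite divr_gt0 // mulr_gt0.
exists s; split=> //.
  rewrite leNgt; apply/negP => s1.
  have h1 : 0 < s * k by rewrite mulr_gt0.
  have h2 : 0 < d * (s * s - 1) by rewrite mulr_gt0 // subr_gt0 mulr_egt1.
  lra.
have h1 : 0 <= s * (k - 2^-1) by rewrite mulr_ge0 ?subr_ge0 // ltW.
have h2 : 0 < d * (s * s) by rewrite mulr_gt0 // mulr_gt0.
lra.
Qed.

(** The difference of the two quadratic equations, factored. *)
Lemma eigenvector_gap d kp kq sp sq : d = sp * (kp + d * sp) ->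
  d = sq * (kq + d * sq) ->
  (sp - sq) * (kq + d * (sp + sq)) = (kq - kp) * sp.
Proof.
move=> ep eq; apply/eqP; rewrite -subr_eq0; apply/eqP.
transitivity (sp * (kp + d * sp) - sq * (kq + d * sq)); first ring.
by rewrite -ep -eq subrr.
Qed.

(** After the affine change sending [powr r] at 1, 2, 2^n to 0, 1, S, the compression has diagonal
    1/2, d^2/2 + (1 - d^2) S and off-diagonal entry d/2. The equation for [s] says that (s, 1) is an
    eigenvector; (1, -s) is orthogonal to it. *)
Lemma gram_eigen_pair r n d s : 0 < d -> d ^+ 2 <= 2^-1 ->
  let S := geom_sum n (2 `^ r) in
  let a := fun3 1 2 (2 ^+ n) in
  let b := fun3 (Num.sqrt 2^-1) (Num.sqrt 2^-1) 0 in
  let c := fun3 (- d * Num.sqrt 2^-1) (d * Num.sqrt 2^-1)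
             (Num.sqrt (1 - d ^+ 2)) in
  let eigval x := powr r 1 + (powr r 2 - powr r 1) * x in
  d = s * ((1 - d ^+ 2) * (2 * S - 1) + d * s) ->
  gram_eigen (powr r) a b c
    (eigval (d ^+ 2 / 2 + (1 - d ^+ 2) * S + d * s / 2)) s 1 /\
  gram_eigen (powr r) a b c (eigval ((1 - d * s) / 2)) 1 (- s).
Proof.
move=> d0 d2 S a b c eigval ds.
have hh : Num.sqrt 2^-1 * Num.sqrt 2^-1 = 2^-1 :> R by rewrite sqrrt // invr_ge0.
have ee : Num.sqrt (1 - d ^+ 2) * Num.sqrt (1 - d ^+ 2) = 1 - d ^+ 2.
  by rewrite sqrrt //; lra.
have fE : powr r (2 ^+ n) = powr r 1 + (powr r 2 - powr r 1) * S.
  exact: powr_geom.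
rewrite /eigval /a /b /c; move: (powr r) fE => f fE.
set h := Num.sqrt 2^-1 in hh *; set e := Num.sqrt (1 - d ^+ 2) in ee *.
have bb : gram f (fun3 1 2 (2 ^+ n)) (fun3 h h 0) (fun3 h h 0) = (f 1 + f 2) / 2.
  by rewrite gram3 hh; field.
have bc : gram f (fun3 1 2 (2 ^+ n)) (fun3 h h 0) (fun3 (- d * h) (d * h) e)
    = d * (f 2 - f 1) / 2.
  transitivity (d * (f 2 - f 1) * (h * h)); last by rewrite hh.
  by rewrite gram3; ring.
have cc : gram f (fun3 1 2 (2 ^+ n)) (fun3 (- d * h) (d * h) e)
      (fun3 (- d * h) (d * h) e)
    = d ^+ 2 * (f 1 + f 2) / 2 + (1 - d ^+ 2) * (f 1 + (f 2 - f 1) * S).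
  transitivity (d ^+ 2 * (f 1 + f 2) * (h * h) + e * e * f (2 ^+ n)).
    by rewrite gram3; ring.
  by rewrite hh ee fE.
rewrite /gram_eigen bb bc cc.
move: (f 1) (f 2) => f1 f2.
set E := s * ((1 - d ^+ 2) * (2 * S - 1) + d * s) in ds.
split; split; apply/eqP; rewrite -subr_eq0; apply/eqP.
- transitivity ((f2 - f1) * (d - E) / 2); first by rewrite /E; field.
  by rewrite -ds subrr mulr0 mul0r.
- by field.
- by field.
- transitivity ((f2 - f1) * (d - E) / 2); first by rewrite /E; field.
  by rewrite -ds subrr mulr0 mul0r.
Qed.

(** The argument lies between [powr q 1] and [powr q 2]. For q < 0 both [powr q] and [invpowr q] are
    decreasing, so the bound 2 persists. *)
Lemma invpowr_segment q x : 0 < x -> x < 1 ->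
  0 < invpowr q (powr q 1 + (powr q 2 - powr q 1) * x) <= 2.
Proof.
move=> x0 x1; rewrite /invpowr /powr powR1 ln1.
case: (ltgtP q 0) => q0.
- have z0 : 0 < 2 `^ q :> R by rewrite powR_gt0.
  have z1 : 2 `^ q <= 1 :> R.
    by rewrite -[leRHS](powRr0 2) ltW // gt1_ltr_powR ?ltr1n.
  rewrite powR_gt0 /=; last nra.
  rewrite [leRHS](_ : _ = (2 `^ q) `^ q^-1); last first.
    by rewrite -powRrM mulfV ?lt_eqF // powRr1.
  by rewrite ler0_ler_powR ?invr_le0 ?(ltW q0) //; nra.
- have z1 : 1 <= 2 `^ q :> R.
    by rewrite -[leLHS](powRr0 2) ltW // gt1_ltr_powR ?ltr1n.
  rewrite powR_gt0 /=; last nra.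
  rewrite [leRHS](_ : _ = (2 `^ q) `^ q^-1); last first.
    by rewrite -powRrM mulfV ?gt_eqF // powRr1.
  by rewrite ge0_ler_powR ?invr_ge0 ?(ltW q0) ?nnegrE //; nra.
- rewrite expR_gt0 /= add0r subr0 -[leRHS](@lnK _ 2) ?posrE //.
  by rewrite ler_expR ler_piMr ?ln_ge0 ?ler1n // ltW.
Qed.

(** In [eigenvector_gap] the factor of sp - sq is at most 3 Sq, kq - kp is at least Sq - Sp, and sp
    is at least d / (2 Sp). The ratio hypothesis gives (1 + z)(Sq - Sp) >= (z - w) Sq, so Sq cancels
    and 6 = 3 * 2 remains. *)
Lemma eigenvector_gap_ge w z d Sp Sq sp sq :
  0 < w -> w < z -> 0 < d -> d ^+ 2 <= 2^-1 -> 1 <= Sp -> 1 <= Sq ->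
  (1 + z) * Sp <= (1 + w) * Sq ->
  0 < sp -> sp <= 1 -> d = sp * ((1 - d ^+ 2) * (2 * Sp - 1) + d * sp) ->
  0 < sq -> sq <= 1 -> d = sq * ((1 - d ^+ 2) * (2 * Sq - 1) + d * sq) ->
  (z - w) * d <= 6 * (1 + z) * Sp * (sp - sq).
Proof.
move=> w0 wz d0 d2 Sp1 Sq1 Spq sp0 sp1 ep sq0 sq1 eq.
have d1 : d <= 1 by nra.
have gap := eigenvector_gap ep eq.
have Kq : 0 < (1 - d ^+ 2) * (2 * Sq - 1) + d * (sp + sq) <= 3 * Sq.
  apply/andP; split.
    by apply: addr_gt0; apply: mulr_gt0; lra.
  have h1 : d * (sp + sq) <= 2.
    have := mulr_ge0 (ltW d0) (ltW sp0); have := mulr_ge0 (ltW d0) (ltW sq0).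
    nra.
  have h2 : 0 <= d ^+ 2 * (2 * Sq - 1) by rewrite mulr_ge0 ?sqr_ge0 //; lra.
  by lra.
have Spq' : Sp <= Sq.
  rewrite -(ler_pM2l (_ : 0 < 1 + z)); last lra.
  by apply: le_trans Spq _; rewrite ler_wpM2r //; lra.
have Kqp : Sq - Sp <= (1 - d ^+ 2) * (2 * Sq - 1) - (1 - d ^+ 2) * (2 * Sp - 1).
  have : 0 <= (2^-1 - d ^+ 2) * (Sq - Sp) by rewrite mulr_ge0 ?subr_ge0.
  by lra.
move: gap Kqp Kq.
move: ((1 - d ^+ 2) * (2 * Sq - 1) + d * (sp + sq)).
move: ((1 - d ^+ 2) * (2 * Sq - 1) - _) => M K gap Kqp /andP[K0 K3].
set D := sp - sq in gap *.
have M0 : 0 <= M by lra.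
have D0 : 0 <= D by rewrite -(pmulr_lge0 _ K0) gap mulr_ge0 // ltW.
have dsp : d <= 2 * Sp * sp.
  have h1 : 0 <= d ^+ 2 * (2 * Sp - 1) by rewrite mulr_ge0 ?sqr_ge0 //; lra.
  have h2 : d * sp <= 1 by nra.
  rewrite {1}ep mulrC ler_wpM2r ?(ltW sp0) //; lra.
have h1 : (Sq - Sp) * sp <= D * (3 * Sq).
  apply: le_trans (_ : M * sp <= _); first by rewrite ler_wpM2r // ltW.
  by rewrite -gap ler_wpM2l.
have h2 : (z - w) * sp <= D * 3 * (1 + z).
  rewrite -(ler_pM2r (lt_le_trans ltr01 Sq1)).
  apply: le_trans (_ : (1 + z) * ((Sq - Sp) * sp) <= _).
    have : 0 <= ((1 + w) * Sq - (1 + z) * Sp) * sp by rewrite mulr_ge0 ?subr_ge0 // ltW.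
    by lra.
  apply: le_trans (_ : (1 + z) * (D * (3 * Sq)) <= _).
    by rewrite ler_wpM2l //; lra.
  by rewrite le_eqVlt; apply/orP; left; apply/eqP; ring.
apply: le_trans (_ : (z - w) * (2 * Sp * sp) <= _).
  by rewrite ler_wpM2l // subr_ge0 ltW.
have -> : (z - w) * (2 * Sp * sp) = 2 * Sp * ((z - w) * sp) by ring.
have -> : 6 * (1 + z) * Sp * D = 2 * Sp * (D * 3 * (1 + z)) by ring.
by rewrite ler_wpM2l //; lra.
Qed.

Lemma unit_box_bound (Y x y : R) : 0 < Y -> Y <= 2 -> 0 < x -> x <= 1 ->
  0 < y -> y <= 1 -> Y * (x ^+ 2 + 1) * (1 + y ^+ 2) <= 8.
Proof.
move=> Y0 Y2 x0 x1 y0 y1.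
have x2 : x ^+ 2 <= 1 by rewrite exprn_ile1 // ltW.
have y2 : y ^+ 2 <= 1 by rewrite exprn_ile1 // ltW.
have x2_ge0 := sqr_ge0 x; have y2_ge0 := sqr_ge0 y.
rewrite [leRHS](_ : _ = 2 * 2 * 2); last by ring.
apply: ler_pM; [by rewrite mulr_ge0 ?addr_ge0 ?(ltW Y0)|by lra| |by lra].
by apply: ler_pM; lra.
Qed.

Lemma isometry_columns d : d ^+ 2 <= 2^-1 ->
  let b := fun3 (Num.sqrt 2^-1) (Num.sqrt 2^-1) 0 in
  let c := fun3 (- d * Num.sqrt 2^-1) (d * Num.sqrt 2^-1)
             (Num.sqrt (1 - d ^+ 2)) in
  [/\ \sum_i b i * b i = 1, \sum_i b i * c i = 0 & \sum_i c i * c i = 1].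
Proof.
move=> d2 b c.
have hh : Num.sqrt 2^-1 * Num.sqrt 2^-1 = 2^-1 :> R by rewrite sqrrt // invr_ge0.
have ee : Num.sqrt (1 - d ^+ 2) * Num.sqrt (1 - d ^+ 2) = 1 - d ^+ 2.
  by rewrite sqrrt //; lra.
rewrite !sum3 /b /c /fun3 /=.
set h := Num.sqrt 2^-1 in hh *; set e := Num.sqrt (1 - d ^+ 2) in ee *.
split; last 1 first.
- transitivity (2 * d ^+ 2 * (h * h) + e * e); first by ring.
  by rewrite hh ee; field.
- by rewrite hh; field.
- by ring.
Qed.

(** [C] depends only on [p] and [q], which leaves [d] free to vary with [n]. *)
Lemma eigen_le_bound p q : eigen_le p q -> p < q ->
  exists C, forall n d, 0 < d -> d ^+ 2 <= 2^-1 ->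
  let S := geom_sum n.+2 (2 `^ p) in
  exists m, [/\ (1 - d ^+ 2) * S <= m, m <= (1 - d ^+ 2) * S + 3 / 2 * d ^+ 2 &
    invpowr p (powr p 1 + (powr p 2 - powr p 1) * m) * d ^+ 2 <= C * S ^+ 2].
Proof.
move=> H pq; set w : R := 2 `^ p; pose z : R := 2 `^ q.
have w0 : 0 < w by rewrite powR_gt0.
have wz : w < z by rewrite gt1_ltr_powR ?ltr1n.
(* 288 = 8 * 36: the bound of [unit_box_bound] times the square of the 6 in [eigenvector_gap_ge]. *)
exists (288 * ((1 + z) / (z - w)) ^+ 2) => n d d0 d2 S.
have d1 : d <= 1 by nra.
pose Sq := geom_sum n.+2 z.
have S1 : 1 <= S by rewrite geom_sum_ge1 // ltW.
have Sq1 : 1 <= Sq by rewrite geom_sum_ge1 // ltW // (lt_trans w0).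
have root T : 1 <= T -> 2^-1 <= (1 - d ^+ 2) * (2 * T - 1) by move=> T1; nra.
have [sp [sp0 sp1 sp2 ep]] := eigenvector_root (root _ S1) d0 d1.
have [sq [sq0 sq1 sq2 eq]] := eigenvector_root (root _ Sq1) d0 d1.
have gap := eigenvector_gap_ge w0 wz d0 d2 S1 Sq1
  (geom_sum_ratio n (ltW w0) (ltW wz)) sp0 sp1 ep sq0 sq1 eq.
exists (d ^+ 2 / 2 + (1 - d ^+ 2) * S + d * sp / 2).
(* This caps the part of the eigenvalue beyond (1 - d^2) S at d^2/2 + d^2. *)
have dsp : d * sp <= 2 * d ^+ 2 by nra.
have dsp0 : 0 < d * sp by rewrite mulr_gt0.
have dd0 : 0 < d ^+ 2 by rewrite exprn_gt0.
split; [by lra|by lra|].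
have [Hu _] := gram_eigen_pair d0 d2 ep; have [_ Hv] := gram_eigen_pair d0 d2 eq.
set X := invpowr p _; have X0 : 0 <= X by exact: invpowr_ge0.
have dsq0 : 0 < d * sq by rewrite mulr_gt0.
have dsq1 : d * sq < 1 by nra.
have [||Y0 Y2] := andP (@invpowr_segment q ((1 - d * sq) / 2) _ _); [by lra|by lra|].
set Y := invpowr q _ in Y0 Y2.
(* The eigenvectors (sp, 1) for [p] and (1, -sq) for [q] have inner product sp - sq. *)
have XD : X * (sp - sq) ^+ 2 <= 8.
  have [X_gt0|X_le0] := ltP 0 X; last first.
    by apply: le_trans (_ : 0 <= _) => //; rewrite mulr_le0_ge0 ?sqr_ge0.
  have a0 i : 0 < @fun3 R 1 2 (2 ^+ n.+2) i.
    by case: i => [[|[|[|//]]] i]; rewrite /fun3 //= exprn_gt0.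
  have [bb bc cc] := isometry_columns d2.
  have u0 : 0 < sp ^+ 2 + 1 ^+ 2 by rewrite addr_gt0 ?exprn_gt0.
  have v0 : 0 < 1 ^+ 2 + (- sq) ^+ 2 by rewrite ltr_wpDr ?sqr_ge0 ?expr1n.
  have := H _ _ _ _ _ _ _ _ _ a0 bb bc cc Hu Hv u0 v0 X_gt0 Y0.
  rewrite -/X -/Y mulr1 mul1r sqrrN expr1n => /le_trans; apply.
  exact: unit_box_bound.
have zw : 0 < z - w by rewrite subr_gt0.
rewrite expr_div_n -(ler_pM2r (exprn_gt0 2 zw)).
have -> : 288 * ((1 + z) ^+ 2 / (z - w) ^+ 2) * S ^+ 2 * (z - w) ^+ 2
    = 36 * ((1 + z) * S) ^+ 2 * 8 by field; rewrite gt_eqF.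
have gap2 : ((z - w) * d) ^+ 2 <= (6 * (1 + z) * S * (sp - sq)) ^+ 2.
  rewrite lerXn2r // nnegrE ?(le_trans _ gap) // mulr_ge0 // ltW //.
have -> : X * d ^+ 2 * (z - w) ^+ 2 = X * ((z - w) * d) ^+ 2 by ring.
apply: le_trans (ler_wpM2l X0 gap2) _.
have -> : X * (6 * (1 + z) * S * (sp - sq)) ^+ 2
    = 36 * ((1 + z) * S) ^+ 2 * (X * (sp - sq) ^+ 2) by ring.
by rewrite ler_wpM2l // mulr_ge0 ?sqr_ge0.
Qed.

End Counterexample.

(** * Exclusion of -1 < p < 1/2, and the six cases *)

Section Conclusion.
Variable R : realType.
Implicit Types p q : R.

(** [W] is w^N and d^2 = W/2. As (w - 1) S = W - 1, the leading part is (3 W - W^2) / 2; the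
    correction is nonpositive and at least -3 W / 8. *)
Lemma eigval_bounds_neg (w W S m : R) : 2^-1 < w -> w < 1 -> 0 < W -> W <= 1 ->
  (w - 1) * S = W - 1 -> (1 - W / 2) * S <= m ->
  m <= (1 - W / 2) * S + 3 / 2 * (W / 2) -> 0 < 1 + (w - 1) * m <= 2 * W.
Proof.
move=> w2 w1 W0 W1 geo m1 m2.
have geo2 : (1 - W / 2) * ((w - 1) * S) = (1 - W / 2) * (W - 1) by rewrite geo.
have h1 : 0 <= (1 - w) * ((1 - W / 2) * S + 3 / 2 * (W / 2) - m).
  by rewrite mulr_ge0 ?subr_ge0 // ltW.
have h2 : 0 <= (1 - w) * (m - (1 - W / 2) * S).
  by rewrite mulr_ge0 ?subr_ge0 // ltW.
have h3 : 0 < W * (w - 2^-1) by rewrite mulr_gt0 ?subr_gt0.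
have h4 : 0 <= W * (1 - W) by rewrite mulr_ge0 ?subr_ge0 // ltW.
have h5 := sqr_ge0 W.
by apply/andP; split; lra.
Qed.

Lemma eigval_ge_pos (w W S m : R) : 1 < w -> (w - 1) * S = W - 1 ->
  (1 - 2^-1) * S <= m -> 2^-1 * W <= 1 + (w - 1) * m.
Proof.
move=> w1 geo m1.
have h : 0 <= (w - 1) * (m - (1 - 2^-1) * S).
  by rewrite mulr_ge0 ?subr_ge0 // ltW.
by lra.
Qed.

(** Geometric growth is played against C N^2. Its base is 2 w for p < 0, above 1 since p > -1; 2 /
    w^2 for p > 0, above 1 since p < 1/2; and sqrt 2 for p = 0. *)
Lemma eigen_le_not_small p q : eigen_le p q -> p < q -> -1 < p -> p < 2^-1 ->
  False.
Proof.
move=> H pq p_gt p_lt; have [C bound] := eigen_le_bound H pq.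
set w : R := 2 `^ p in bound.
have w0 : 0 < w by rewrite powR_gt0.
have half : 2 `^ (-1) = 2^-1 :> R by rewrite powR_inv1.
have expw n : w ^+ n = (2 ^+ n) `^ p.
  by rewrite -(powR_mulrn n (ltW w0)) -(powR_mulrn n (ler0n R 2)) -!powRrM mulrC.
suff [x [k [x1 k0 growth]]] : exists x k : R, [/\ 1 < x, 0 < k &
    forall n, k * x ^+ n.+2 <= C * n.+2%:R ^+ 2].
  have [n] := expr_gt_quad (C / k) x1; apply/negP; rewrite -leNgt.
  by rewrite mulrAC ler_pdivlMr // mulrC.
(* The sign of [C] allows [S] to be replaced by an upper bound; it is read off at d = 1/2. *)
have C0 : 0 <= C.
  have [d [d0 d2]] : exists d : R, 0 < d /\ d ^+ 2 <= 2^-1.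
    exists 2^-1; split; first by rewrite invr_gt0.
    by rewrite expr2 ler_piMl ?invr_ge0 // invf_le1 // ler1n.
  have [m [_ _]] := bound 0%N d d0 d2.
  set S := geom_sum _ _; have S0 : 0 < S ^+ 2.
    by rewrite exprn_gt0 // (lt_le_trans ltr01) // geom_sum_ge1 // ltW.
  move=> /(le_trans _) b; rewrite -(pmulr_lge0 _ S0); apply: b.
  by rewrite mulr_ge0 ?invpowr_ge0 ?sqr_ge0.
case: (ltgtP p 0) => p0.
- have w1 : w < 1 by rewrite -[ltRHS](powRr0 2) gt1_ltr_powR ?ltr1n.
  have w2 : 2^-1 < w by rewrite -half gt1_ltr_powR ?ltr1n.
  exists (2 * w), (2 `^ p^-1 / 2); split; [by lra|by rewrite divr_gt0 ?powR_gt0|].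
  move=> n; set N := n.+2.
  have wN0 : 0 < w ^+ N by rewrite exprn_gt0.
  have wN1 : w ^+ N <= 1 by rewrite exprn_ile1 // ltW.
  (* Since 1/p < 0, the mean reaches order 2^N only if the eigenvalue is O(w^N), which forces d^2 to
     be that small too. *)
  pose d := Num.sqrt (w ^+ N / 2).
  have dd : d ^+ 2 = w ^+ N / 2 by rewrite sqr_sqrtr // divr_ge0 // ltW.
  have d0 : 0 < d by rewrite sqrtr_gt0 divr_gt0.
  have [|m [m1 m2]] := bound n d d0; first by rewrite dd; lra.
  have := geom_sum_ge1 (isT : (0 < N)%N) (ltW w0).
  have := geom_sum_le N (ltW w0) (ltW w1).
  have geo : (w - 1) * geom_sum N w = w ^+ N - 1 by rewrite subrX1.
  move: m1 m2 geo; rewrite /invpowr /powr lt_eqF // powR1 -/w dd.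
  set S := geom_sum _ _ => m1 m2 geo SN S1 le_C.
  set X := 1 + (w - 1) * m in le_C.
  have /andP[X0 X1] := eigval_bounds_neg w2 w1 wN0 wN1 geo m1 m2.
  have le_X : 2 `^ p^-1 * 2 ^+ N <= X `^ p^-1.
    have -> : 2 `^ p^-1 * 2 ^+ N = (2 * w ^+ N) `^ p^-1 :> R.
      by rewrite powRM ?(ltW wN0) // expw -powRrM mulfV ?lt_eqF // powRr1 // exprn_ge0.
    by rewrite ler0_ler_powR // invr_le0 ltW.
  apply: le_trans (_ : C * S ^+ 2 <= _); last first.
    by rewrite ler_wpM2l // lerXn2r ?nnegrE // (le_trans ler01).
  apply: le_trans le_C; rewrite exprMn.
  have -> : 2 `^ p^-1 / 2 * (2 ^+ N * w ^+ N) = 2 `^ p^-1 * 2 ^+ N * (w ^+ N / 2).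
    by ring.
  by rewrite ler_wpM2r // divr_ge0 // ltW.
- have w1 : 1 < w by rewrite -[ltLHS](powRr0 2) gt1_ltr_powR ?ltr1n.
  have w2 : w ^+ 2 < 2.
    rewrite expw -[ltRHS]powRr1 // -powR_mulrn // -powRrM gt1_ltr_powR ?ltr1n //.
    by lra.
  have ww : 0 < w ^+ 2 by rewrite exprn_gt0.
  exists (2 / w ^+ 2), (2^-1 `^ p^-1 / 2); split.
  + by rewrite ltr_pdivlMr // mul1r.
  + by rewrite divr_gt0 ?powR_gt0 // invr_gt0.
  move=> n; set N := n.+2.
  have wN0 : 0 < w ^+ N by rewrite exprn_gt0.
  have wN1 : 1 <= w ^+ N by rewrite exprn_ege1 // ltW.
  (* Here the eigenvalue has order w^N at fixed coupling, so the largest admissible [d] is taken. *)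
  pose d : R := Num.sqrt 2^-1.
  have dd : d ^+ 2 = 2^-1 by rewrite sqr_sqrtr // invr_ge0.
  have d0 : 0 < d by rewrite sqrtr_gt0 invr_gt0.
  have [|m [m1 _]] := bound n d d0; first by rewrite dd.
  have := geom_sum_le_expr N (ltW w1).
  have := geom_sum_ge1 (isT : (0 < N)%N) (ltW w0).
  have geo : (w - 1) * geom_sum N w = w ^+ N - 1 by rewrite subrX1.
  move: m1 geo; rewrite /invpowr /powr gt_eqF // powR1 -/w dd.
  set S := geom_sum _ _ => m1 geo S1 SN le_C.
  set X := 1 + (w - 1) * m in le_C.
  have X1 : 2^-1 * w ^+ N <= X := eigval_ge_pos w1 geo m1.
  have le_X : 2^-1 `^ p^-1 * 2 ^+ N <= X `^ p^-1.
    have -> : 2^-1 `^ p^-1 * 2 ^+ N = (2^-1 * w ^+ N) `^ p^-1 :> R.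
      rewrite powRM ?(ltW wN0) ?invr_ge0 //.
      by rewrite expw -powRrM mulfV ?gt_eqF // powRr1 // exprn_ge0.
    have h0 : 0 <= 2^-1 * w ^+ N by rewrite mulr_ge0 ?invr_ge0 // ltW.
    by rewrite ge0_ler_powR ?invr_ge0 ?(ltW p0) ?nnegrE // (le_trans h0).
  have le_S : S ^+ 2 <= N%:R ^+ 2 * (w ^+ 2) ^+ N.
    have S0 := le_trans ler01 S1; have SN0 := le_trans S0 SN.
    by rewrite -exprM mulnC exprM -exprMn lerXn2r.
  have wwN : 0 < (w ^+ 2) ^+ N by rewrite exprn_gt0.
  rewrite expr_div_n -(ler_pM2r wwN).
  have -> : 2^-1 `^ p^-1 / 2 * (2 ^+ N / (w ^+ 2) ^+ N) * (w ^+ 2) ^+ N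
      = 2^-1 `^ p^-1 * 2 ^+ N * 2^-1 by field; rewrite gt_eqF.
  rewrite -[leRHS]mulrA; apply: le_trans (ler_wpM2l C0 le_S).
  by apply: le_trans le_C; rewrite ler_wpM2r // invr_ge0.
- have wE : w = 1 by rewrite /w p0 powRr0.
  rewrite wE in bound.
  exists (Num.sqrt 2), 2^-1; split; [|by rewrite invr_gt0|].
    by rewrite -[ltLHS]sqrtr1 ltr_sqrt // ltr1n.
  move=> n; set N := n.+2.
  pose d : R := Num.sqrt 2^-1.
  have dd : d ^+ 2 = 2^-1 by rewrite sqr_sqrtr // invr_ge0.
  have d0 : 0 < d by rewrite sqrtr_gt0 invr_gt0.
  have [|m [m1 _]] := bound n d d0; first by rewrite dd.
  (* With S = N and m >= N/2, the mean exp(m ln 2) is at least (sqrt 2)^N. *)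
  have SN : geom_sum N (1 : R) = N%:R.
    rewrite /geom_sum; under eq_bigr do rewrite expr1n.
    by rewrite sumr_const card_ord.
  move: m1; rewrite /invpowr /powr p0 eqxx ln1 SN dd add0r subr0 => m1.
  apply: le_trans; rewrite mulrC ler_wpM2r ?invr_ge0 //.
  have -> : Num.sqrt 2 ^+ N = sequences.expR (ln 2 * (N%:R / 2)) :> R.
    by rewrite mulrCA expRM_natl -powR12_sqrt // /powR gt_eqF // mulrC.
  rewrite ler_expR ler_wpM2l ?ln_ge0 ?ler1n //; lra.
Qed.

End Conclusion.

Unset Implicit Arguments.

Theorem theorem2p4 (R : realType) (p q : R)
  (h : forall Phi : {linear 'M[R[i]]_3 -> 'M[R[i]]_2},
         unital Phi -> completely_positive Phi ->
         forall A : 'M[R[i]]_3, pdmx A ->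
           loewner_le (power_mean Phi p A) (power_mean Phi q A)) :
  p = q
  \/ 1 <= p < q
  \/ p < q <= -1
  \/ (p <= -1 /\ 1 <= q)
  \/ (1 / 2 <= p < 1 /\ 1 <= q)
  \/ (p <= -1 /\ -1 < q <= - (1 / 2)).
Proof.
have H := power_mean_le_eigen_le h.
have := eigen_le_leq H; rewrite le_eqVlt => /orP[/eqP|pq]; first by left.
have p_out : ~ (-1 < p < 2^-1).
  by case/andP => p1 p2; exact: eigen_le_not_small H pq p1 p2.
(* Inversion carries the forbidden interval over to [q], as -1 < -q < 1/2. *)
have q_out : ~ (- 2^-1 < q < 1).
  case/andP => q1 q2; apply: (eigen_le_not_small (eigen_le_opp H));
    rewrite ?ltrN2 // ltrNl // opprK.
(* Now p <= -1 or p >= 1/2, and q <= -1/2 or q >= 1; with p < q, only listed cases remain. *)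
rewrite div1r; have [p1|p1] := leP p (-1).
  have [q1|q1] := leP 1 q; first by do 3 right; left.
  have q2 : q <= - 2^-1 by rewrite leNgt; apply/negP => q2; apply: q_out; rewrite q2.
  have [q3|q3] := leP q (-1); first by do 2 right; left; rewrite pq.
  by do 5 right.
have p2 : 2^-1 <= p by rewrite leNgt; apply/negP => p2; apply: p_out; rewrite p1.
have q1 : 1 <= q.
  rewrite leNgt; apply/negP => q1; apply: q_out; rewrite q1 andbT.
  by apply: lt_trans pq; apply: lt_le_trans p2; rewrite gtrN ?invr_gt0.
have [p3|p3] := leP 1 p; first by right; left; rewrite pq.
by do 4 right; left; rewrite p2.
Qed.
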